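(* Let $3<p<\infty$ and $\frac1p+\frac1q=1$. Let $\mathfrak J:l_p\to l_q$ be the mapping $\mathfrak J(x)=\left\{\frac{|t_n|^{p-1}\mathrm{sign}(t_n)}{1+|t_n|}\right\}_{n=1}^\infty$ for $x=(t_1,t_2,\dots)\in l_p$. Let $\bar x=\{\bar t_n\}_{n=1}^\infty\in l_p$ and $\bar y\in l_q$ with $\mathfrak J(\bar x)=\bar y$. Then the covering constant for $\mathfrak J$ at $(\bar x,\bar y)$ satisfies $$\hat\alpha(\mathfrak J,\bar x,\bar y)=0.$$
   Context: $(l_p,\|\cdot\|_p)$ and $(l_q,\|\cdot\|_q)$ are the real sequence spaces, $l_p^*=l_q$, $l_q^*=l_p$, and $\langle\cdot,\cdot\rangle$ is the canonical real pairing $\sum_n a_nb_n$ of elements of $l_q$ and $l_p$. The Mordukhovich derivative (Fréchet coderivative) of $\mathfrak J$ at $(x,y)$, $y=\mathfrak J(x)$, is the set-valued map $\widehat D^*\mathfrak J(x,y):l_p\rightrightarrows l_q$, $$\widehat D^*\mathfrak J(x,y)(w)=\left\{z\in l_q:\limsup_{u\to x,\,u\in l_p}\frac{\langle z,u-x\rangle-\langle w,\mathfrak J(u)-\mathfrak J(x)\rangle}{\|u-x\|_p+\|\mathfrak J(u)-\mathfrak J(x)\|_q}\le0\right\},\quad w\in l_p.$$ The covering constant for $\mathfrak J$ at $(\bar x,\bar y)$, $\bar y=\mathfrak J(\bar x)$, is $$\hat\alpha(\mathfrak J,\bar x,\bar y)=\sup_{\eta>0}\inf\left\{\|z\|_q:\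 z\in\widehat D^*\mathfrak J(x,y)(w),\ x\in\mathbb B_{l_p}(\bar x,\eta),\ y=\mathfrak J(x)\in\mathbb B_{l_q}(\bar y,\eta),\ \|w\|_p=1\right\},$$ where $\mathbb B_X(a,\eta)$ is the closed ball in $X$ with center $a$ and radius $\eta$. *)

(* Defs.v *)
From mathcomp Require Import all_boot all_order all_algebra.
From mathcomp Require Import all_classical all_reals all_analysis.

Set Implicit Arguments.
Unset Strict Implicit.
Unset Printing Implicit Defensive.

Import Order.TTheory GRing.Theory Num.Theory.
Import numFieldNormedType.Exports.

Local Open Scope classical_set_scope.
Local Open Scope ring_scope.

Definition lp (R : realType) (p : R) : set (nat -> R) :=
  [set a | a \in Lfun counting p%:E].

Definition lp_norm (R : realType) (p : R) (a : nat -> R) : R :=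
  fine 'N[counting]_p%:E[EFin \o a]%E.

Definition lp_pairing (R : realType) (a b : nat -> R) : R :=
  limn (series (a \* b)).

(* limsup of f at x along points of l_p distinct from x. *)
Definition lp_limsup (R : realType) (p : R) (f : (nat -> R) -> \bar R)
    (x : nat -> R) : \bar R :=
  ereal_inf [set ereal_sup
      (f @` [set u | lp p u /\ u <> x /\ lp_norm p (u - x) < delta])
    | delta in [set delta : R | 0 < delta]].

(* The coderivative is empty at points (x, y) off the graph of F. *)
Definition coderivative (R : realType) (p q : R)
    (F : (nat -> R) -> nat -> R) (x y w : nat -> R) : set (nat -> R) :=
  [set z | lp q z /\ y = F x /\
    (lp_limsup p (fun u =>
       ((lp_pairing z (u - x) - lp_pairing w (F u - F x)) /
        (lp_norm p (u - x) + lp_norm q (F u - F x)))%:E) x <= 0)%E].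

(* sup and inf are taken in the extended reals, where inf set0 = +oo. *)
Definition covering_constant (R : realType) (p q : R)
    (F : (nat -> R) -> nat -> R) (xbar ybar : nat -> R) : \bar R :=
  ereal_sup [set ereal_inf [set m | exists x y w z : nat -> R,
        lp p x /\ lp_norm p (x - xbar) <= eta /\
        y = F x /\ lp q y /\ lp_norm q (y - ybar) <= eta /\
        lp p w /\ lp_norm p w = 1 /\
        coderivative p q F x y w z /\ m = (lp_norm q z)%:E]
    | eta in [set eta : R | 0 < eta]].

Definition Jmap (R : realType) (p : R) (x : nat -> R) : nat -> R :=
  fun n => `|x n| `^ (p - 1) * Num.sg (x n) / (1 + `|x n|).

Lemma lpP (R : realType) (p : R) (a : nat -> R) : 0 < p ->
  lp p a <-> (\sum_(n <oo) (`|a n| `^ p)%:E < +oo)%E.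
Proof.
move=> p0.
have E : ('N[counting]_p%:E[EFin \o a] =
    (\sum_(n <oo) (`|a n| `^ p)%:E) `^ p^-1)%E.
  by rewrite Lnorm_counting.
have -> : lp p a <-> ('N[counting]_p%:E[EFin \o a] < +oo)%E.
  split=> [/andP[_ /set_mem//]|h].
  by apply/andP; split; apply/mem_set.
rewrite E; split; last exact: poweR_lty.
by apply: lty_poweRy; rewrite invr_neq0// gt_eqF.
Qed.

Lemma Jmap_lp (R : realType) (p q : R) (x : nat -> R) : 3 < p ->
  p^-1 + q^-1 = 1 -> lp p x -> lp q (Jmap p x).
Proof.
move=> p3 pq.
have p0 : 0 < p by apply: lt_trans p3.
have p1 : 1 < p by apply: lt_trans p3; rewrite ltr1n.
have q'E : q^-1 = 1 - p^-1 by apply/eqP; rewrite eq_sym subr_eq addrC pq.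
have q0 : 0 < q by rewrite -invr_gt0 q'E subr_gt0 invf_lt1.
have pqE : (p - 1) * q = p.
  apply: (mulIf (x := q^-1)); first by rewrite gt_eqF ?invr_gt0.
  by rewrite mulfK ?gt_eqF// q'E mulrBr mulr1 divff ?gt_eqF.
move=> /(lpP _ p0) xp; apply/(lpP _ q0); apply: le_lt_trans xp.
apply: lee_nneseries => n _; first by rewrite lee_fin powR_ge0.
rewrite lee_fin -[in leRHS]pqE powRrM; apply: ge0_ler_powR; first exact: ltW.
- by rewrite nnegrE.
- by rewrite nnegrE powR_ge0.
rewrite /Jmap !normrM normfV (ger0_norm (powR_ge0 _ _)) normr_sg.
rewrite (ger0_norm (addr_ge0 ler01 (normr_ge0 _))) -mulrA ler_piMr ?powR_ge0//.
rewrite ler_pdivrMr ?ltr_pwDl// mul1r.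
by case: (x n != 0); rewrite ?lerDl// addr_ge0.
Qed.

Lemma is_cvg_lp_pairing (R : realType) (p q : R) (a b : nat -> R) :
  0 < p -> 0 < q -> p^-1 + q^-1 = 1 -> lp p a -> lp q b ->
  cvgn (series (a \* b)).
Proof.
move=> p0 q0 pq /andP[/set_mem ma /set_mem na] /andP[/set_mem mb /set_mem nb].
have : ('N[counting]_1[EFin \o (a \* b)%R] < +oo)%E.
  apply: (le_lt_trans (hoelder counting ma mb p0 q0 pq)).
  by rewrite lte_mul_pinfty ?Lnorm_ge0 ?ge0_fin_numE ?Lnorm_ge0.
rewrite Lnorm_counting// invr1 poweRe1; last first.
  by apply: nneseries_ge0 => n _ _; rewrite poweR_ge0.
set S := (X in (X < _)%E) => Sy.
have S0 : (0 <= S)%E by apply: nneseries_ge0 => n _ _; rewrite poweR_ge0.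
apply: normed_cvg; apply: nondecreasing_is_cvgn.
  by apply: nondecreasing_series => n _ _; exact: normr_ge0.
exists (fine S) => _ [n _ <-].
rewrite -lee_fin fineK ?ge0_fin_numE// /series/= -sumEFin.
apply: le_trans (nneseries_lim_ge n _); last by move=> k _; rewrite poweR_ge0.
by apply: lee_sum => k _; rewrite /= powRr1.
Qed.

(* Main.v *)
Require Import Defs.
From mathcomp Require Import all_boot all_order all_algebra.
From mathcomp Require Import all_classical all_reals all_analysis.
Import Order.TTheory GRing.Theory Num.Theory.
Import numFieldNormedType.Exports.
Local Open Scope classical_set_scope.
Local Open Scope ring_scope.

(** The covering constant vanishes because [Jmap p] is flat along every
    coordinate axis at the points where that coordinate is zero. If [x n = 0],
    then [|Jmap p u n| <= |u n|^(p-1)] and [|u n| <= ||u - x||_p]; since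
    [p - 1 > 1], the [n]-th coordinate of [Jmap p] has zero derivative at [x].
    Hence [z = 0] lies in the coderivative at [x] in the unit direction
    [w = e_n] ([coderivative_Jmap_spike]).

    Such points exist arbitrarily close to [xbar]: the entries of [xbar] and of
    [Jmap p xbar] tend to zero ([lp_near0]), and replacing the [n]-th entry of
    [xbar] by zero moves [xbar] by [|xbar n|] and its image by
    [|Jmap p xbar n|]. So each infimum in the definition of the covering
    constant is attained, with value 0. *)

(** The multiple [c e_n] of the [n]-th unit vector. *)
Definition spike {R : realType} (n : nat) (c : R) : nat -> R :=
  fun k => if k == n then c else 0.

Definition zero_entry {R : realType} (n : nat) (a : nat -> R) : nat -> R :=
  fun k => if k == n then 0 else a k.

Lemma zero_entryE (R : realType) (n : nat) (a : nat -> R) :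
  zero_entry n a = a - spike n (a n).
Proof.
apply/funext => k; rewrite /zero_entry /spike !fctE.
by case: eqVneq => [->|_]; rewrite ?subrr ?subr0.
Qed.

Lemma zero_entry_sub (R : realType) (n : nat) (a : nat -> R) :
  zero_entry n a - a = spike n (- a n).
Proof.
apply/funext => k; rewrite /zero_entry /spike !fctE.
by case: eqVneq => [->|_]; rewrite ?sub0r ?subrr.
Qed.

Lemma Jmap_zero_entry (R : realType) (p : R) (n : nat) (x : nat -> R) :
  Jmap p (zero_entry n x) = zero_entry n (Jmap p x).
Proof.
apply/funext => k; rewrite /Jmap /zero_entry.
by case: eqP => // _; rewrite sgr0 mulr0 mul0r.
Qed.

Lemma lp_normE (R : realType) (p : R) (a : nat -> R) : 0 < p ->
  lp_norm p a = fine ((\sum_(n <oo) (`|a n| `^ p)%:E) `^ p^-1)%E.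
Proof.
by move=> p0; rewrite /lp_norm Lnorm_counting.
Qed.

Lemma lp_norm_ge0 (R : realType) (p : R) (a : nat -> R) : 0 <= lp_norm p a.
Proof. by rewrite /lp_norm fine_ge0// Lnorm_ge0. Qed.

Lemma spike_sum (R : realType) (p : R) (n : nat) (c : R) : p != 0 ->
  (\sum_(k <oo) (`|spike n c k| `^ p)%:E = (`|c| `^ p)%:E)%E.
Proof.
move=> p0; rewrite (nneseriesD1 (n := n))//.
rewrite eseries0 /spike => [|k _ /negbTE/= ->].
  by rewrite eqxx adde0.
by rewrite normr0 powR0.
Qed.

Lemma lp_spike (R : realType) (p : R) (n : nat) (c : R) : 0 < p ->
  lp p (spike n c).
Proof.
by move=> p0; apply/lpP => //; rewrite spike_sum ?gt_eqF// ltry.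
Qed.

Lemma lp_norm_spike (R : realType) (p : R) (n : nat) (c : R) : 0 < p ->
  lp_norm p (spike n c) = `|c|.
Proof.
move=> p0; rewrite lp_normE// spike_sum ?gt_eqF// poweR_EFin/= -powRrM.
by rewrite divff ?gt_eqF// powRr1.
Qed.

Lemma spike0 (R : realType) (n : nat) : spike n 0 = 0 :> (nat -> R).
Proof. by apply/funext => k; rewrite /spike if_same. Qed.

Lemma lp0 (R : realType) (p : R) : 0 < p -> lp p (0 : nat -> R).
Proof. by rewrite -(spike0 _ 0); exact: lp_spike. Qed.

Lemma lp_norm0 (R : realType) (p : R) : 0 < p -> lp_norm p (0 : nat -> R) = 0.
Proof. by move=> p0; rewrite -(spike0 _ 0) lp_norm_spike// normr0. Qed.

Lemma lpB (R : realType) (p : R) (a b : nat -> R) : 1 <= p ->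
  lp p a -> lp p b -> lp p (a - b).
Proof.
move=> p1 pa pb; apply: (Lfun_addr_closed _ _).2 => //.
exact: Lfun_oppr_closed.
Qed.

Lemma lp_norm_ge_coord (R : realType) (p : R) (a : nat -> R) (n : nat) :
  0 < p -> lp p a -> `|a n| <= lp_norm p a.
Proof.
move=> p0 /(lpP _ p0) ap; rewrite lp_normE//.
have a0 k : (0 <= (`|a k| `^ p)%:E)%E by rewrite lee_fin powR_ge0.
have -> : `|a n| = fine ((`|a n| `^ p)%:E `^ p^-1)%E.
  by rewrite poweR_EFin/= -powRrM divff ?gt_eqF// powRr1.
have s0 : (0 <= \sum_(k <oo) (`|a k| `^ p)%:E)%E.
  by apply: nneseries_ge0 => k _ _.
apply: fine_le.
- by rewrite poweR_EFin.
- by rewrite ge0_fin_numE ?poweR_ge0// poweR_lty.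
- apply: gt0_ler_poweR; rewrite ?invr_ge0 ?(ltW p0)//.
    by rewrite in_itv/= a0 leey.
    by rewrite in_itv/= s0 leey.
  by rewrite (nneseriesD1 (n := n))// leeDl// nneseries_ge0.
Qed.

(** Argued through the tails of the series of [p]-th powers, which tend to zero
    and dominate their first terms; the estimate [|a n| <= e] is the pull-back
    of [|a n|^p <= e^p]. *)
Lemma lp_near0 (R : realType) (p : R) (a : nat -> R) (e : R) : 0 < p -> 0 < e ->
  lp p a -> \forall n \near \oo, `|a n| <= e.
Proof.
move=> p0 e0 /(lpP _ p0) ap.
have a0 k : (0 <= (`|a k| `^ p)%:E)%E by rewrite lee_fin powR_ge0.
have /fine_cvgP[fin /cvgr0_norm_lt] := nneseries_tail_cvg ap (fun k _ => a0 k).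
move=> /(_ (e `^ p) (powR_gt0 _ e0)) small.
near=> n.
rewrite leNgt; apply/negP => ea.
have : fine (\sum_(n <= k <oo) (`|a k| `^ p)%:E)%E < e `^ p.
  by apply: le_lt_trans (ler_norm _) _; near: n.
apply/negP; rewrite -leNgt -lee_fin fineK; last by near: n.
rewrite (nneseries_split n 1)// addn1 big_nat1.
apply: le_trans (leeDl _ _); last by apply: nneseries_ge0.
by rewrite lee_fin ge0_ler_powR ?nnegrE ?(ltW p0) ?(ltW e0) ?(ltW ea).
Unshelve. all: by end_near.
Qed.

Lemma lp_pairing_spike (R : realType) (n : nat) (b : nat -> R) :
  lp_pairing (spike n 1) b = b n.
Proof.
apply: cvg_lim => //.
apply: cvg_near_cst; near=> m.
have nm : (n < m)%N by near: m; exact: nbhs_infty_gt.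
rewrite /series/= (bigD1_seq n) ?mem_index_iota ?iota_uniq//=.
rewrite /spike eqxx mul1r big1 ?addr0// => k /negbTE ->.
by rewrite mul0r.
Unshelve. all: by end_near.
Qed.

Lemma lp_pairing0 (R : realType) (b : nat -> R) :
  lp_pairing (0 : nat -> R) b = 0.
Proof.
apply: cvg_lim => //.
apply: cvg_near_cst; near=> m.
by rewrite /series/= big1// => k _; rewrite mul0r.
Unshelve. all: by end_near.
Qed.

Lemma Jmap_coord_le (R : realType) (p : R) (u : nat -> R) (n : nat) :
  `|Jmap p u n| <= `|u n| `^ (p - 1).
Proof.
rewrite /Jmap !normrM normfV (ger0_norm (powR_ge0 _ _)) normr_sg.
rewrite (ger0_norm (addr_ge0 ler01 (normr_ge0 _))) -mulrA ler_piMr ?powR_ge0//.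
rewrite ler_pdivrMr ?ltr_pwDl// mul1r.
by case: (u n != 0); rewrite ?lerDl// addr_ge0.
Qed.

(** Powers of a number in [0, 1] decrease with the exponent, and [p - 1 >= 2].
    An integer exponent keeps real powers out of the difference quotient. *)
Lemma Jmap_coord_le_sqr (R : realType) (p : R) (u : nat -> R) (n : nat) :
  3 <= p -> `|u n| <= 1 -> `|Jmap p u n| <= `|u n| ^+ 2.
Proof.
move=> p3 u1; apply: le_trans (Jmap_coord_le _ _ _ _) _.
have [->|u0] := eqVneq (u n) 0.
  rewrite normr0 powR0 ?expr0n// gt_eqF// subr_gt0.
  by apply: lt_le_trans p3; rewrite ltr1n.
rewrite -powR_mulrn//; apply: ger_powR; first by rewrite normr_gt0 u0.
by rewrite lerBrDr natr1.
Qed.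

(** With [z = 0] and [w = e_n] the quotient is [- Jmap p u n] over a denominator
    that is at least [||u - x||_p >= |u n|], whereas the numerator is
    [O(|u n|^2)]. *)
Lemma coderivative_Jmap_spike (R : realType) (p q : R) (x : nat -> R)
    (n : nat) :
  3 <= p -> 0 < q -> lp p x -> x n = 0 ->
  coderivative p q (Jmap p) x (Jmap p x) (spike n 1) 0.
Proof.
move=> p3 q0 px xn0; split; first exact: lp0.
have p1 : 1 <= p by apply: le_trans p3; rewrite ler1n.
have p0 : 0 < p by apply: lt_le_trans p1.
split=> //; apply/lee_addgt0Pr => e e0; rewrite add0e.
(* On the ball of radius d, the 1 gives access to the quadratic bound and
   the e turns that bound into e times the denominator. *)
pose d := Num.min 1 e.
apply: (@le_trans _ _ (ereal_sup ((fun u : nat -> R =>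
       ((lp_pairing 0 (u - x) - lp_pairing (spike n 1) (Jmap p u - Jmap p x)) /
        (lp_norm p (u - x) + lp_norm q (Jmap p u - Jmap p x)))%:E) @`
     [set u | lp p u /\ u <> x /\ lp_norm p (u - x) < d]))).
  by apply: ereal_inf_lbound; exists d => //=; rewrite lt_min ltr01.
apply: ge_ereal_sup => _ [u [pu [_ ud]] <-].
rewrite lee_fin lp_pairing0 lp_pairing_spike sub0r !fctE.
have -> : Jmap p x n = 0 by rewrite /Jmap xn0 sgr0 mulr0 mul0r.
rewrite subr0.
have := lp_norm_ge_coord _ _ _ n p0 (lpB _ _ _ _ p1 pu px).
rewrite !fctE xn0 subr0 => unD.
move: ud; rewrite lt_min => /andP[ud1 ude].
set D := lp_norm p _ in unD ud1 ude *; set E := lp_norm q _.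
have D0 : 0 <= D by exact: lp_norm_ge0.
have E0 : 0 <= E by exact: lp_norm_ge0.
(* A zero denominator makes the quotient 0, because 0^-1 = 0. *)
have [DE0|DE0] := eqVneq (D + E) 0; first by rewrite DE0 invr0 mulr0 ltW.
rewrite ler_pdivrMr ?lt_def ?DE0 ?addr_ge0//.
apply: le_trans (_ : `|Jmap p u n| <= _); first by rewrite -normrN ler_norm.
apply: le_trans (Jmap_coord_le_sqr _ _ _ _ p3 _) _.
  exact: le_trans unD (ltW ud1).
rewrite expr2 ler_pM//; first exact: le_trans unD (ltW ude).
by apply: le_trans unD _; rewrite lerDl.
Qed.

Theorem theorem7p5 (R : realType) (p q : R) (xbar ybar : nat -> R)
    (hp : 3 < p) (hpq : p^-1 + q^-1 = 1)
    (hx : lp p xbar) (hy : lp q ybar) (hxy : Jmap p xbar = ybar) :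
  covering_constant p q (Jmap p) xbar ybar = 0%:E.
Proof.
have p1 : 1 < p by apply: lt_trans hp; rewrite ltr1n.
have p0 : 0 < p by apply: lt_trans p1.
have q0 : 0 < q.
  by rewrite -invr_gt0 -(addKr p^-1 q^-1) hpq addrC subr_gt0 invf_lt1.
apply/eqP; rewrite eq_le; apply/andP; split.
- apply: ge_ereal_sup => _ [eta eta0 <-]; apply: ereal_inf_lbound.
  have [n [xn yn]] : exists n, `|xbar n| <= eta /\ `|ybar n| <= eta.
    near \oo => n; exists n.
    by split; near: n; [exact: lp_near0 hx|exact: lp_near0 hy].
  have lx : lp p (zero_entry n xbar).
    by rewrite zero_entryE; apply: lpB => //; [exact: ltW|exact: lp_spike].
  exists (zero_entry n xbar), (Jmap p (zero_entry n xbar)), (spike n 1), 0.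
  split=> //; split; first by rewrite zero_entry_sub lp_norm_spike// normrN.
  split=> //; split; first exact: Jmap_lp hp hpq lx.
  split.
    by rewrite Jmap_zero_entry hxy zero_entry_sub lp_norm_spike// normrN.
  split; first exact: lp_spike.
  split; first by rewrite lp_norm_spike// normr1.
  split; last by rewrite lp_norm0.
  apply: coderivative_Jmap_spike => //; first exact: ltW.
  by rewrite /zero_entry eqxx.
- apply: le_ereal_sup_tmp; eexists; first by exists 1 => //=.
  apply: le_ereal_inf_tmp => m.
  move=> [x [y [w [z [_ [_ [_ [_ [_ [_ [_ [_ ->]]]]]]]]]]]].
  by rewrite lee_fin lp_norm_ge0.
Unshelve. all: by end_near.
Qed.
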